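(* Let $q\in\mathbb C$ with $0<|q|<1$, let $z\in\mathbb C\setminus\{0\}$ and $\lambda\in\mathbb C$. For all $t\in\mathbb C$ small enough (that is, for all $t$ with $|t|<\delta$ for some $\delta>0$), $$\sum_{n=0}^\infty \varphi_n(z;q)\,t^n=\frac{(q^zt;q)_\infty}{(t;q)_\infty\,(zt;q)_\infty},$$ $$\sum_{n=0}^\infty (q^\lambda;q)_n\,\varphi_n(z;q)\,t^n=\frac{1}{(zt;q)_\lambda}\;{}_2\phi_1\left(\begin{array}{c} q^\lambda,\ q^z\\ ztq^\lambda\end{array};q,t\right),$$ where the principal values of $q^z$ and $q^\lambda$ are taken.
   Context: For $a\in\mathbb C$: $(a;q)_0=1$, $(a;q)_n=(1-a)(1-aq)\cdots(1-aq^{n-1})$ for $n\ge 1$, $(a;q)_\infty=\prod_{i\ge 0}(1-aq^i)$, and for complex $\lambda$, $(a;q)_\lambda=(a;q)_\infty/(aq^\lambda;q)_\infty$ (whenever the denominator is nonzero). The principal value is $q^a=\exp(a\,\mathrm{Log}\,q)$. The basic hypergeometric series is $${}_r\phi_s\left(\begin{array}{c} a_1,\dots,a_r\\ b_1,\dots,b_s\end{array};q,x\right)=\sum_{k=0}^\infty\frac{(a_1;q)_k\cdots(a_r;q)_k}{(b_1;q)_k\cdots(b_s;q)_k}\left((-1)^kq^{k(k-1)/2}\right)^{1+s-r}\frac{x^k}{(q;q)_k},$$ where the $b_i$ are such that the denominators never vanish. For integers $n\ge 0$, the $q$-Sylvester polynomial is $$\varphi_n(z;q)=\frac{z^n}{(q;q)_n}\;{}_2\phi_0\left(\begin{array}{c}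 q^{-n},\ q^z\\ \text{--}\end{array};q,q^nz^{-1}\right)$$ (a terminating series, with no denominator parameters). *)

(* Defs.v *)
From Stdlib Require Import Reals List ZArith Lra.
From Coquelicot Require Import Coquelicot.
Import ListNotations.
Open Scope C_scope.

Definition Cexp (z : C) : C :=
  ((exp (Re z) * cos (Im z))%R, (exp (Re z) * sin (Im z))%R).

(* Principal argument, in (-PI, PI], for z <> 0. *)
Definition Carg (z : C) : R :=
  if Rle_dec 0 (Im z) then acos (Re z / Cmod z) else (- acos (Re z / Cmod z))%R.

Definition CLog (z : C) : C := (ln (Cmod z), Carg z).

(* Principal value of q^a, for q <> 0. *)
Definition Cpowc (q a : C) : C := Cexp (a * CLog q).

Definition Cpowz (x : C) (m : Z) : C :=
  match m with
  | Z0 => 1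
  | Zpos p => x ^ Pos.to_nat p
  | Zneg p => / (x ^ Pos.to_nat p)
  end.

(* Taken componentwise, which is correct whenever [u] converges in C
   (see [Clim_correct]); otherwise the value is meaningless. *)
Definition Clim (u : nat -> C) : C :=
  (real (Lim_seq (fun n => Re (u n))), real (Lim_seq (fun n => Im (u n)))).

Definition CSeries (a : nat -> C) : C := Clim (sum_n a).

(* [qpoch a q n] is (a;q)_n, [qpoch_inf a q] is (a;q)_oo and
   [qpoch_cplx a q lambda] is (a;q)_lambda for complex lambda. *)

Fixpoint qpoch (a q : C) (n : nat) : C :=
  match n with
  | O => 1
  | S m => qpoch a q m * (1 - a * q ^ m)
  end.

Definition qpoch_inf (a q : C) : C := Clim (qpoch a q).

Definition qpoch_cplx (a q lambda : C) : C :=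
  qpoch_inf a q / qpoch_inf (a * Cpowc q lambda) q.

Definition qpochs (l : list C) (q : C) (k : nat) : C :=
  fold_right (fun a p => qpoch a q k * p) 1 l.

(* The basic hypergeometric series r_phi_s; r and s are the lengths of the
   two parameter lists, so 1 + s - r is an integer that may be negative. *)
Definition qhyp_term (num den : list C) (q x : C) (k : nat) : C :=
  qpochs num q k / qpochs den q k
  * Cpowz ((- (1)) ^ k * q ^ (k * (k - 1) / 2)%nat)
          (1 + Z.of_nat (length den) - Z.of_nat (length num))
  * (x ^ k / qpoch q q k).

Definition qhyp (num den : list C) (q x : C) : C :=
  CSeries (qhyp_term num den q x).

Definition qSylvester (n : nat) (z q : C) : C :=
  z ^ n / qpoch q q n
  * qhyp [Cpowz q (- Z.of_nat n); Cpowc q z] [] q (q ^ n * / z).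

Lemma Clim_correct (u : nat -> C) (l : C) :
  filterlim u eventually (locally l) -> Clim u = l.
Proof.
  intros H.
  assert (Hb := proj1 (filterlim_locally u l) H).
  assert (Hr : is_lim_seq (fun n => Re (u n)) (Re l)).
  { apply filterlim_locally; intros eps; generalize (Hb eps).
    apply filter_imp; intros n [Hn _]; exact Hn. }
  assert (Hi : is_lim_seq (fun n => Im (u n)) (Im l)).
  { apply filterlim_locally; intros eps; generalize (Hb eps).
    apply filter_imp; intros n [_ Hn]; exact Hn. }
  unfold Clim.
  rewrite (is_lim_seq_unique _ _ Hr), (is_lim_seq_unique _ _ Hi).
  destruct l; reflexivity.
Qed.

Lemma CSeries_correct (a : nat -> C) (l : C) : is_series a l -> CSeries a = l.
Proof. exact (Clim_correct (sum_n a) l). Qed.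

Lemma Cexp_CLog (z : C) : z <> 0 -> Cexp (CLog z) = z.
Proof.
  intros Hz.
  assert (Hm : (0 < Cmod z)%R) by (apply Cmod_gt_0; exact Hz).
  assert (Hsq : (Cmod z * Cmod z = Re z * Re z + Im z * Im z)%R).
  { unfold Cmod; rewrite sqrt_sqrt; [unfold Re, Im; ring|].
    apply Rplus_le_le_0_compat; apply pow2_ge_0. }
  assert (Hc : (-1 <= Re z / Cmod z <= 1)%R).
  { assert (H := Rmult_le_compat_r _ _ _ (Rlt_le _ _ (Rinv_0_lt_compat _ Hm)) (re_le_Cmod z)).
    rewrite Rinv_r in H by lra.
    assert (H' : (Rabs (Re z / Cmod z) <= 1)%R).
    { unfold Rdiv; rewrite Rabs_mult, (Rabs_right (/ Cmod z)); [exact H|].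
      apply Rle_ge, Rlt_le, Rinv_0_lt_compat, Hm. }
    apply Rabs_le_between in H'; lra. }
  assert (Hs : (sqrt (1 - (Re z / Cmod z)²) = Rabs (Im z) / Cmod z)%R).
  { rewrite <- (sqrt_Rsqr (Rabs (Im z) / Cmod z)).
    - f_equal; unfold Rdiv; rewrite !Rsqr_mult, <- Rsqr_abs; unfold Rsqr.
      apply Rmult_eq_reg_r with (Cmod z * Cmod z)%R; [|nra].
      field_simplify; nra.
    - apply Rmult_le_pos; [apply Rabs_pos | left; apply Rinv_0_lt_compat, Hm]. }
  unfold Cexp, CLog, Carg; simpl; rewrite exp_ln by exact Hm.
  destruct (Rle_dec 0 (Im z)) as [Hi|Hi].
  - rewrite cos_acos, sin_acos, Hs, Rabs_right by (exact Hc || lra).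
    rewrite (surjective_pairing z) at 7; f_equal; unfold Re, Im; field; lra.
  - rewrite cos_neg, sin_neg, cos_acos, sin_acos, Hs, Rabs_left by (exact Hc || lra).
    rewrite (surjective_pairing z) at 7; f_equal; unfold Re, Im; field; lra.
Qed.

(* Main.v *)
Require Import Defs.
From Stdlib Require Import Reals List ZArith Lra Lia.
From Coquelicot Require Import Coquelicot.
Import ListNotations.
Open Scope C_scope.

(** Everything reduces to one double series.  Write [w] for [q^z].  Reversing
    the factor [(q^-n;q)_k] turns the terminating 2-phi-0 series into the
    convolution
      [phi_n = sum_(k <= n) (w;q)_k / (q;q)_k * z^(n-k) / (q;q)_(n-k)]
    ([qSylvester_eq_convolution]); here the negative powers of [q] cancel
    exactly against the argument [q^n / z].

    For an arbitrary complex [A], put this into [sum_n (A;q)_n phi_n t^n] and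
    sum over [k] and [j = n - k] instead of [n].  Since
    [(A;q)_(k+j) = (A;q)_k (A q^k;q)_j], the sum over [j] is an instance of the
    q-binomial theorem
      [sum_j (a;q)_j / (q;q)_j x^j = (a x;q)_oo / (x;q)_oo]
    with [a = A q^k] and [x = z t] ([q_binomial]), and
    [(z t A q^k;q)_oo = (z t A;q)_oo / (z t A;q)_k].  What is left is a constant
    times the 2-phi-1 series ([generating_function]).  The second identity is
    the case [A = q^lambda].  The first is the case [A = 0], where the remaining
    2-phi-1 series is itself summed by the q-binomial theorem.

    Analytically, two uniform estimates suffice: the products [(a;q)_n] are
    bounded above, and bounded away from 0 when [|a| < 1].  They give the
    convergence and nonvanishing of the infinite products, and they dominate
    the double series by [M r^(k+j)] with [r < 1], which justifies the
    rearrangement ([is_series_diagonal]). *)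

(** * Complex sequences and series *)

Lemma filterlim_C_squeeze (u : nat -> C) (l : C) (b : nat -> R) :
  (forall n, Cmod (u n - l) <= b n)%R -> is_lim_seq b 0 ->
  filterlim u eventually (locally l).
Proof.
  intros H Hb.
  apply (filterlim_locally_ball_norm (K := C_AbsRing) (U := C_NormedModule)).
  intros eps; apply is_lim_seq_spec in Hb; destruct (Hb eps) as [N HN].
  exists N; intros n Hn; change (Cmod (u n - l) < eps)%R.
  specialize (HN n Hn); rewrite Rminus_0_r in HN.
  apply Rabs_lt_between in HN; specialize (H n); lra.
Qed.

(** The multiplication of [C] is continuous for the uniform structure of the
    modulus, whereas limits here use the product structure on pairs;
    [locally_C] says that the neighbourhoods are the same. *)
Lemma filterlim_C_mult (u v : nat -> C) (l m : C) :
  filterlim u eventually (locally l) -> filterlim v eventually (locally m) ->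
  filterlim (fun n => u n * v n) eventually (locally (l * m)).
Proof.
  intros Hu Hv.
  apply (filterlim_comp_2 u v Cmult Hu Hv); intros P HP.
  destruct (@filterlim_mult C_AbsRing l m P (proj1 (locally_C _ _) HP)) as [Q R HQ HR H].
  exact (Filter_prod _ _ _ Q R (proj2 (locally_C _ _) HQ) (proj2 (locally_C _ _) HR) H).
Qed.

Lemma filterlim_C_unique (u : nat -> C) (l m : C) :
  filterlim u eventually (locally l) -> filterlim u eventually (locally m) -> l = m.
Proof. intros Hl Hm; rewrite <- (Clim_correct _ _ Hl); exact (Clim_correct _ _ Hm). Qed.

Lemma is_series_C_unique (u : nat -> C) (l m : C) :
  is_series u l -> is_series u m -> l = m.
Proof. apply filterlim_C_unique. Qed.

Lemma is_series_C_ext (u v : nat -> C) (l : C) :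
  (forall n, u n = v n) -> is_series u l -> is_series v l.
Proof. exact (is_series_ext u v l). Qed.

Lemma is_series_C_scal (c : C) (u : nat -> C) (l : C) :
  is_series u l -> is_series (fun n => c * u n) (c * l).
Proof. exact (is_series_scal (K := C_AbsRing) (V := C_NormedModule) c u l). Qed.

Lemma is_series_C_tail (u : nat -> C) (l : C) (m : nat) :
  is_series u l -> is_series (fun n => u (S m + n)%nat) (l - sum_n u m).
Proof.
  intros Hu; apply is_series_incr_n; [lia|].
  match goal with |- is_series _ ?s => replace s with l; [exact Hu|] end.
  change (l = l - sum_n u m + sum_n u m); ring.
Qed.

Lemma sum_n_C_ext (u v : nat -> C) (n : nat) :
  (forall k, (k <= n)%nat -> u k = v k) -> sum_n u n = sum_n v n :> C.
Proof. exact (sum_n_ext_loc u v n). Qed.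

Lemma sum_n_C_mult (c : C) (u : nat -> C) (n : nat) :
  sum_n (fun k => c * u k) n = c * sum_n u n.
Proof. exact (sum_n_mult_l (K := C_Ring) c u n). Qed.

Lemma is_series_C_finite (u : nat -> C) (n : nat) :
  (forall k, (n < k)%nat -> u k = 0) -> is_series u (sum_n u n).
Proof.
  intros H.
  assert (E : forall m, sum_n u (n + m) = sum_n u n).
  { induction m as [|m IH]; [rewrite Nat.add_0_r; reflexivity|].
    rewrite Nat.add_succ_r, sum_Sn, IH, H by lia; exact (Cplus_0_r _). }
  apply (filterlim_locally_ball_norm (K := C_AbsRing) (U := C_NormedModule)).
  intros eps; exists n; intros m Hm.
  replace m with (n + (m - n))%nat by lia; rewrite E.
  apply (ball_norm_center (K := C_AbsRing) (V := C_NormedModule)).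
Qed.

Lemma Cmod_sum_n_le (u : nat -> C) (b : nat -> R) (n : nat) :
  (forall k, (k <= n)%nat -> Cmod (u k) <= b k)%R ->
  (Cmod (sum_n u n) <= sum_n b n)%R.
Proof.
  induction n as [|n IH]; intros H.
  - rewrite !sum_O; apply H; lia.
  - rewrite !sum_Sn.
    eapply Rle_trans; [apply Cmod_triangle|].
    apply Rplus_le_compat; [apply IH; intros k Hk; apply H | apply H]; lia.
Qed.

Lemma is_series_Cmod_le (u : nat -> C) (l : C) (b : nat -> R) (s : R) :
  is_series u l -> is_series b s -> (forall n, Cmod (u n) <= b n)%R ->
  (Cmod l <= s)%R.
Proof.
  intros Hu Hb H.
  assert (Hn : is_lim_seq (fun n => Cmod (sum_n u n)) (Cmod l)).
  { apply (filterlim_comp _ _ _ (sum_n u) Cmod eventually (locally l) (locally (Cmod l)) Hu).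
    exact (@filterlim_norm C_AbsRing C_NormedModule l). }
  refine (is_lim_seq_le _ (sum_n b) (Cmod l) s _ Hn Hb).
  intros n; apply Cmod_sum_n_le; auto.
Qed.

Lemma is_series_geom_scal (M r : R) :
  (0 <= r < 1)%R -> is_series (fun n => M * r ^ n)%R (M * / (1 - r))%R.
Proof.
  intros Hr; apply (is_series_scal (K := R_AbsRing) (V := R_NormedModule) M).
  apply is_series_geom; rewrite Rabs_pos_eq; lra.
Qed.

Lemma ex_series_C_geom (u : nat -> C) (M r : R) :
  (0 <= r < 1)%R -> (forall n, Cmod (u n) <= M * r ^ n)%R -> ex_series u.
Proof.
  intros Hr H.
  apply (@ex_series_le C_AbsRing C_CompleteNormedModule u (fun n => M * r ^ n)%R H).
  eexists; apply is_series_geom_scal, Hr.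
Qed.

Lemma sum_n_diagonal (f : nat -> nat -> C) (N : nat) :
  sum_n (fun n => sum_n (fun k => f k (n - k)%nat) n) N
  = sum_n (fun k => sum_n (f k) (N - k)) N.
Proof.
  induction N as [|N IH].
  - rewrite !sum_O; reflexivity.
  - rewrite sum_Sn, IH, !(sum_Sn _ N), Nat.sub_diag, sum_O.
    rewrite (sum_n_ext_loc (fun k => sum_n (f k) (S N - k))
               (fun k => plus (sum_n (f k) (N - k)) (f k (S N - k)%nat))).
    + rewrite sum_n_plus; apply plus_assoc.
    + intros k Hk; rewrite (Nat.sub_succ_l k N Hk), sum_Sn; reflexivity.
Qed.

(** Under geometric domination the partial sum of the diagonal series differs
    from that of the iterated series only by tails: row [k] is cut at [N - k]
    and its tail is at most [M r^k r^(N-k) / (1 - r)].  The sum of these bounds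
    is the general term of the Cauchy square of a geometric series, a
    convergent series, and so it tends to 0. *)
Lemma is_series_diagonal (f : nat -> nat -> C) (G : nat -> C) (s : C) (M r : R) :
  (0 <= r < 1)%R ->
  (forall k j, Cmod (f k j) <= M * r ^ (k + j))%R ->
  (forall k, is_series (f k) (G k)) ->
  is_series G s ->
  is_series (fun n => sum_n (fun k => f k (n - k)%nat) n) s.
Proof.
  intros Hr Hf HG HS.
  set (e := fun n : nat => (M * / (1 - r) * sum_f_R0 (fun k => r ^ k * r ^ (n - k)) n)%R).
  assert (He : is_lim_seq e 0).
  { apply (ex_series_lim_0 e), (ex_series_scal (K := R_AbsRing) (V := R_NormedModule)).
    assert (Hg : is_series (fun n => r ^ n)%R (/ (1 - r))%R)
      by (apply is_series_geom; rewrite Rabs_pos_eq; lra).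
    eexists; apply (is_series_mult_pos _ _ _ _ Hg Hg); intros n; apply pow_le, Hr. }
  assert (Htail : forall k m, (Cmod (sum_n (f k) m - G k) <= M * / (1 - r) * (r ^ k * r ^ m))%R).
  { intros k m.
    replace (sum_n (f k) m - G k) with (- (G k - sum_n (f k) m)) by ring.
    rewrite Cmod_opp.
    replace (M * / (1 - r) * (r ^ k * r ^ m))%R
      with ((M * r ^ (k + m)) * / (1 - r))%R by (rewrite pow_add; ring).
    apply (is_series_Cmod_le (fun j => f k (S m + j)%nat) _
             (fun j => M * r ^ (k + m) * r ^ j)%R).
    - apply is_series_C_tail, HG.
    - apply is_series_geom_scal, Hr.
    - intros j; eapply Rle_trans; [apply Hf|].
      rewrite Rmult_assoc, <- pow_add.
      assert (HM : (0 <= M)%R).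
      { specialize (Hf 0%nat 0%nat); simpl in Hf; generalize (Cmod_ge_0 (f 0%nat 0%nat)); lra. }
      apply Rmult_le_compat_l; [exact HM|].
      replace (k + (S m + j))%nat with (S (k + m + j)) by lia.
      simpl; generalize (pow_le r (k + m + j) (proj1 Hr)); intros; nra. }
  assert (Hdiff : filterlim (fun N => sum_n (fun k => sum_n (f k) (N - k) - G k) N)
                    eventually (locally (RtoC 0))).
  { apply (filterlim_C_squeeze _ _ e); [|exact He].
    intros N; unfold e; rewrite <- sum_n_Reals.
    unfold Cminus at 1; rewrite Copp_0, Cplus_0_r.
    rewrite <- (sum_n_mult_l (K := R_AbsRing)).
    apply Cmod_sum_n_le; intros k _; apply Htail. }
  assert (Hsum := filterlim_comp_2 _ _ plus HS Hdiff
                    (@filterlim_plus C_AbsRing C_NormedModule s (RtoC 0))).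
  change (plus s (RtoC 0)) with (s + 0) in Hsum; rewrite Cplus_0_r in Hsum.
  refine (filterlim_ext _ _ _ Hsum).
  intros N; rewrite sum_n_diagonal, <- sum_n_plus.
  apply sum_n_ext; intros k.
  change (G k + (sum_n (f k) (N - k) - G k) = sum_n (f k) (N - k)); ring.
Qed.

(** * q-Pochhammer symbols *)

Lemma qpoch_add (a q : C) (n m : nat) :
  qpoch a q (n + m) = qpoch a q n * qpoch (a * q ^ n) q m.
Proof.
  induction m as [|m IH].
  - rewrite Nat.add_0_r; simpl; ring.
  - rewrite Nat.add_succ_r; simpl; rewrite IH, Cpow_add_r; ring.
Qed.

Lemma qpoch_0_l (q : C) (n : nat) : qpoch 0 q n = 1.
Proof. induction n as [|n IH]; simpl; [reflexivity | rewrite IH; ring]. Qed.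

Lemma Cpow_le_1 (q : C) (n : nat) : (Cmod q < 1)%R -> (0 <= Cmod q ^ n <= 1)%R.
Proof.
  intros Hq; split; [apply pow_le, Cmod_ge_0|].
  rewrite <- (pow1 n); apply pow_incr; split; [apply Cmod_ge_0 | lra].
Qed.

(** Uniform bounds on products [prod_(i < n) (1 + c rho^i)] come from
    [1 + x <= exp x]: the exponents add up to a partial geometric sum. *)
Lemma exp_geom_bound (c rho : R) (n : nat) :
  (0 <= c)%R -> (0 <= rho < 1)%R ->
  (exp (c * ((1 - rho ^ n) / (1 - rho))) <= exp (c / (1 - rho)))%R.
Proof.
  intros Hc Hr.
  assert (H : (c * ((1 - rho ^ n) / (1 - rho)) <= c / (1 - rho))%R).
  { unfold Rdiv; rewrite <- Rmult_assoc.
    apply Rmult_le_compat_r; [left; apply Rinv_0_lt_compat; lra|].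
    generalize (pow_le rho n (proj1 Hr)); intros; nra. }
  destruct H as [H|H]; [left; apply exp_increasing, H | right; f_equal; exact H].
Qed.

Lemma exp_geom_step (c rho : R) (n : nat) :
  (rho < 1)%R ->
  (exp (c * ((1 - rho ^ S n) / (1 - rho)))
   = exp (c * ((1 - rho ^ n) / (1 - rho))) * exp (c * rho ^ n))%R.
Proof. intros Hr; rewrite <- exp_plus; f_equal; simpl; field; lra. Qed.

Lemma qpoch_upper_bound (a q : C) (n : nat) :
  (Cmod q < 1)%R -> (Cmod (qpoch a q n) <= exp (Cmod a / (1 - Cmod q)))%R.
Proof.
  intros Hq; assert (Hq0 := Cmod_ge_0 q); assert (Ha := Cmod_ge_0 a).
  eapply Rle_trans; [|apply (exp_geom_bound _ _ n); lra].
  induction n as [|n IH].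
  - simpl; rewrite Cmod_1; right.
    replace (Cmod a * ((1 - 1) / (1 - Cmod q)))%R with 0%R by (field; lra).
    symmetry; apply exp_0.
  - rewrite exp_geom_step by exact Hq; simpl; rewrite Cmod_mult.
    apply Rmult_le_compat; [apply Cmod_ge_0 | apply Cmod_ge_0 | exact IH |].
    eapply Rle_trans; [apply Cmod_triangle|].
    rewrite Cmod_opp, Cmod_1, Cmod_mult, Cmod_pow; apply exp_ineq1_le.
Qed.

(** The reciprocal of each factor obeys the same kind of bound, since
    [1 / (1 - y) <= 1 + y / (1 - |a|) <= exp (y / (1 - |a|))] for
    [0 <= y <= |a|], applied with [y = |a| |q|^i]. *)
Lemma qpoch_lower_bound (a q : C) (n : nat) :
  (Cmod q < 1)%R -> (Cmod a < 1)%R ->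
  (1 <= Cmod (qpoch a q n) * exp (Cmod a / (1 - Cmod a) / (1 - Cmod q)))%R.
Proof.
  intros Hq Ha1; assert (Hq0 := Cmod_ge_0 q); assert (Ha := Cmod_ge_0 a).
  set (c := (Cmod a / (1 - Cmod a))%R).
  assert (Hc : (0 <= c)%R)
    by (apply Rmult_le_pos; [lra | left; apply Rinv_0_lt_compat; lra]).
  eapply Rle_trans;
    [|apply Rmult_le_compat_l; [apply Cmod_ge_0 | apply (exp_geom_bound _ _ n); lra]].
  induction n as [|n IH].
  - simpl; rewrite Cmod_1.
    replace (c * ((1 - 1) / (1 - Cmod q)))%R with 0%R by (field; lra).
    rewrite exp_0; lra.
  - rewrite exp_geom_step by exact Hq; simpl; rewrite Cmod_mult.
    assert (Hf : (1 <= Cmod (1 - a * q ^ n) * exp (c * Cmod q ^ n))%R).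
    { set (y := (Cmod a * Cmod q ^ n)%R).
      assert (Hy : (0 <= y <= Cmod a)%R)
        by (generalize (Cpow_le_1 q n Hq); intros; unfold y; nra).
      assert (H1 : (1 - y <= Cmod (1 - a * q ^ n))%R).
      { assert (H := Cmod_triangle (1 - a * q ^ n) (a * q ^ n)).
        replace (1 - a * q ^ n + a * q ^ n) with (RtoC 1) in H by ring.
        rewrite Cmod_1, Cmod_mult, Cmod_pow in H; fold y in H; lra. }
      assert (H2 := exp_ineq1_le (c * Cmod q ^ n)).
      replace (c * Cmod q ^ n)%R with (y / (1 - Cmod a))%R in H2 |- *
        by (unfold y, c; field; lra).
      assert (H3 : (1 <= (1 - y) * (1 + y / (1 - Cmod a)))%R).
      { replace ((1 - y) * (1 + y / (1 - Cmod a)))%R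
          with (1 + y * (Cmod a - y) * / (1 - Cmod a))%R by (field; lra).
        assert (0 <= y * (Cmod a - y) * / (1 - Cmod a))%R; [|lra].
        apply Rmult_le_pos; [nra | left; apply Rinv_0_lt_compat; lra]. }
      eapply Rle_trans; [exact H3|].
      apply Rmult_le_compat; try lra.
      assert (0 <= y / (1 - Cmod a))%R; [|lra].
      apply Rmult_le_pos; [lra | left; apply Rinv_0_lt_compat; lra]. }
    replace (Cmod (qpoch a q n) * Cmod (1 - a * q ^ n) *
        (exp (c * ((1 - Cmod q ^ n) / (1 - Cmod q))) * exp (c * Cmod q ^ n)))%R
      with ((Cmod (qpoch a q n) * exp (c * ((1 - Cmod q ^ n) / (1 - Cmod q)))) *
        (Cmod (1 - a * q ^ n) * exp (c * Cmod q ^ n)))%R by ring.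
    nra.
Qed.

Lemma qpoch_neq_0 (a q : C) (n : nat) :
  (Cmod q < 1)%R -> (Cmod a < 1)%R -> qpoch a q n <> 0.
Proof.
  intros Hq Ha H; generalize (qpoch_lower_bound a q n Hq Ha).
  rewrite H, Cmod_0; lra.
Qed.

(** The increments [(a;q)_(n+1) - (a;q)_n = - (a;q)_n a q^n] are geometrically
    small because [(a;q)_n] is bounded, so the products converge as a
    telescoping series. *)
Lemma filterlim_qpoch (a q : C) :
  (Cmod q < 1)%R -> filterlim (qpoch a q) eventually (locally (qpoch_inf a q)).
Proof.
  intros Hq; assert (Hq0 := Cmod_ge_0 q).
  set (d := fun n => match n with O => RtoC 1 | S m => - (qpoch a q m * (a * q ^ m)) end).
  assert (Hd : ex_series d).
  { apply (ex_series_incr_1 (K := C_AbsRing) (V := C_NormedModule)).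
    apply (ex_series_C_geom _ (exp (Cmod a / (1 - Cmod q)) * Cmod a) (Cmod q)); [lra|].
    intros n; unfold d; rewrite Cmod_opp, !Cmod_mult, Cmod_pow, Rmult_assoc.
    apply Rmult_le_compat_r; [|apply qpoch_upper_bound, Hq].
    apply Rmult_le_pos; [apply Cmod_ge_0 | apply pow_le, Hq0]. }
  destruct Hd as [l Hl].
  assert (H : filterlim (qpoch a q) eventually (locally l)).
  { apply (filterlim_ext (sum_n d)); [|exact Hl]; intros n.
    induction n as [|n IH]; [exact (sum_O d)|].
    rewrite sum_Sn, IH.
    change (qpoch a q n + - (qpoch a q n * (a * q ^ n)) = qpoch a q n * (1 - a * q ^ n)); ring. }
  unfold qpoch_inf; rewrite (Clim_correct _ _ H); exact H.
Qed.

Lemma qpoch_inf_0_l (q : C) : qpoch_inf 0 q = 1.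
Proof.
  apply Clim_correct, (filterlim_ext (fun _ => RtoC 1));
    [intros n; symmetry; apply qpoch_0_l | apply filterlim_const].
Qed.

Lemma qpoch_inf_shift (a q : C) (n : nat) :
  (Cmod q < 1)%R -> qpoch_inf a q = qpoch a q n * qpoch_inf (a * q ^ n) q.
Proof.
  intros Hq; apply Clim_correct.
  assert (H := filterlim_C_mult _ _ _ _ (filterlim_const (F := eventually) (qpoch a q n))
                 (filterlim_qpoch (a * q ^ n) q Hq)).
  apply (filterlim_locally_ball_norm (K := C_AbsRing) (U := C_NormedModule)).
  intros eps.
  apply (filterlim_locally_ball_norm (K := C_AbsRing) (U := C_NormedModule)) with (eps := eps) in H.
  destruct H as [N HN]; exists (n + N)%nat; intros m Hm.
  replace m with (n + (m - n))%nat by lia; rewrite qpoch_add; apply HN; lia.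
Qed.

Lemma qpoch_inf_neq_0 (a q : C) :
  (Cmod q < 1)%R -> (Cmod a < 1)%R -> qpoch_inf a q <> 0.
Proof.
  intros Hq Ha H0.
  set (K := exp (Cmod a / (1 - Cmod a) / (1 - Cmod q))).
  assert (HK : (0 < K)%R) by apply exp_pos.
  assert (H := filterlim_qpoch a q Hq).
  apply (filterlim_locally_ball_norm (K := C_AbsRing) (U := C_NormedModule))
    with (eps := mkposreal _ (Rinv_0_lt_compat _ HK)) in H.
  destruct H as [N HN]; specialize (HN N (Nat.le_refl N)).
  change (Cmod (qpoch a q N - qpoch_inf a q) < / K)%R in HN.
  replace (qpoch a q N - qpoch_inf a q) with (qpoch a q N) in HN by (rewrite H0; ring).
  assert (H := qpoch_lower_bound a q N Hq Ha); fold K in H.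
  apply (Rmult_lt_compat_r K) in HN; [|exact HK].
  rewrite Rinv_l in HN by lra; lra.
Qed.

Lemma inv_qpoch_bound (a q : C) :
  (Cmod q < 1)%R -> (Cmod a < 1)%R ->
  exists B : R, forall n, (Cmod (/ qpoch a q n) <= B)%R.
Proof.
  intros Hq Ha; exists (exp (Cmod a / (1 - Cmod a) / (1 - Cmod q))); intros n.
  assert (Hne := qpoch_neq_0 a q n Hq Ha).
  rewrite Cmod_inv by exact Hne.
  apply (Rmult_le_reg_l (Cmod (qpoch a q n))); [apply Cmod_gt_0, Hne|].
  rewrite Rinv_r; [apply qpoch_lower_bound; assumption|].
  apply Rgt_not_eq, Cmod_gt_0, Hne.
Qed.

(** * The q-binomial theorem *)

Definition qbinom_coef (a q : C) (n : nat) : C := qpoch a q n / qpoch q q n.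

Lemma qbinom_coef_bound (a q : C) :
  (Cmod q < 1)%R -> exists B : R, forall n, (Cmod (qbinom_coef a q n) <= B)%R.
Proof.
  intros Hq; destruct (inv_qpoch_bound q q Hq Hq) as [B HB].
  exists (exp (Cmod a / (1 - Cmod q)) * B)%R; intros n.
  unfold qbinom_coef, Cdiv; rewrite Cmod_mult.
  apply Rmult_le_compat; auto using Cmod_ge_0, qpoch_upper_bound.
Qed.

Lemma ex_series_qbinom (a q x : C) :
  (Cmod q < 1)%R -> (Cmod x < 1)%R -> ex_series (fun n => qbinom_coef a q n * x ^ n).
Proof.
  intros Hq Hx; destruct (qbinom_coef_bound a q Hq) as [B HB].
  apply (ex_series_C_geom _ B (Cmod x)); [split; [apply Cmod_ge_0 | exact Hx]|].
  intros n; rewrite Cmod_mult, Cmod_pow.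
  apply Rmult_le_compat_r; [apply pow_le, Cmod_ge_0 | apply HB].
Qed.

Lemma qbinom_coef_succ (a q : C) (n : nat) :
  (Cmod q < 1)%R ->
  qbinom_coef a q (S n) * (1 - q * q ^ n) = qbinom_coef a q n * (1 - a * q ^ n).
Proof.
  intros Hq; assert (Hn := qpoch_neq_0 q q n Hq Hq); assert (HS := qpoch_neq_0 q q (S n) Hq Hq).
  unfold qbinom_coef; simpl in HS |- *; field; split; [exact Hn|].
  intros H; apply HS; rewrite H; ring.
Qed.

(** The coefficient recurrence [qbinom_coef_succ] makes
    [F x - F (x q) = x (F x - a F (x q))] hold term by term after a shift of
    the index, the two constant terms cancelling on the left. *)
Lemma qbinom_functional_eq (a q x F G : C) :
  (Cmod q < 1)%R ->
  is_series (fun n => qbinom_coef a q n * x ^ n) F ->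
  is_series (fun n => qbinom_coef a q n * (x * q) ^ n) G ->
  (1 - x) * F = (1 - a * x) * G.
Proof.
  intros Hq HF HG.
  assert (H1 : is_series (fun n => qbinom_coef a q (S n) * x ^ S n
                                   - qbinom_coef a q (S n) * (x * q) ^ S n) (F - G)).
  { assert (H := is_series_C_tail _ _ 0 (is_series_minus _ _ _ _ HF HG)).
    rewrite sum_O in H; simpl in H.
    replace (F - G) with (F - G - (qbinom_coef a q 0 * 1 - qbinom_coef a q 0 * 1)) by ring.
    exact H. }
  assert (H2 : is_series (fun n => x * (qbinom_coef a q n * x ^ n
                                   + - a * (qbinom_coef a q n * (x * q) ^ n))) (x * (F + - a * G))).
  { apply is_series_C_scal.
    exact (is_series_plus _ _ _ _ HF (is_series_C_scal (- a) _ _ HG)). }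
  assert (E : F - G = x * (F + - a * G)).
  { apply (is_series_C_unique _ _ _ H1).
    refine (is_series_C_ext _ _ _ _ H2); intros n.
    rewrite !Cpow_mult_l, !Cpow_S.
    transitivity (x * x ^ n * (qbinom_coef a q n * (1 - a * q ^ n))); [ring|].
    rewrite <- qbinom_coef_succ by exact Hq; ring. }
  transitivity (F - G + G - x * F); [ring|]; rewrite E; ring.
Qed.

(** Iterating the functional equation gives
    [F x * (x;q)_n = (a x;q)_n * F (x q^n)]; let [n] tend to infinity and use
    that [F] is continuous at 0 with value 1. *)
Theorem q_binomial (a q x : C) :
  (Cmod q < 1)%R -> (Cmod x < 1)%R ->
  is_series (fun n => qbinom_coef a q n * x ^ n) (qpoch_inf (a * x) q / qpoch_inf x q).
Proof.
  intros Hq Hx; assert (Hq0 := Cmod_ge_0 q).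
  assert (Hxq : forall n, (Cmod (x * q ^ n) <= Cmod x)%R).
  { intros n; rewrite Cmod_mult, Cmod_pow.
    generalize (Cpow_le_1 q n Hq) (Cmod_ge_0 x); intros; nra. }
  set (F := fun n => CSeries (fun k => qbinom_coef a q k * (x * q ^ n) ^ k)).
  assert (HF : forall n, is_series (fun k => qbinom_coef a q k * (x * q ^ n) ^ k) (F n)).
  { intros n; destruct (ex_series_qbinom a q (x * q ^ n) Hq) as [l Hl].
    - specialize (Hxq n); lra.
    - unfold F; rewrite (CSeries_correct _ _ Hl); exact Hl. }
  assert (Hiter : forall n, F 0%nat * qpoch x q n = qpoch (a * x) q n * F n).
  { intros n; induction n as [|n IH]; [simpl; ring|].
    assert (E : (1 - x * q ^ n) * F n = (1 - a * (x * q ^ n)) * F (S n)).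
    { apply (qbinom_functional_eq a q _ _ _ Hq (HF n)).
      refine (is_series_C_ext _ _ _ _ (HF (S n))); intros k.
      f_equal; f_equal; rewrite Cpow_S; ring. }
    simpl; rewrite Cmult_assoc, IH, <- !Cmult_assoc, (Cmult_comm (F n)), E.
    ring. }
  assert (Hlim : filterlim F eventually (locally (RtoC 1))).
  { destruct (qbinom_coef_bound a q Hq) as [B HB].
    assert (HB0 : (0 <= B)%R) by (eapply Rle_trans; [apply Cmod_ge_0 | apply (HB 0%nat)]).
    apply (filterlim_C_squeeze _ _ (fun n => B * / (1 - Cmod x) * Cmod q ^ n)%R).
    - intros n.
      replace (B * / (1 - Cmod x) * Cmod q ^ n)%R
        with (B * Cmod q ^ n * / (1 - Cmod x))%R by ring.
      apply (is_series_Cmod_le (fun k => qbinom_coef a q (S k) * (x * q ^ n) ^ S k) _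
               (fun k => B * Cmod q ^ n * Cmod x ^ k)%R).
      + assert (H := is_series_C_tail _ _ 0 (HF n)); rewrite sum_O in H.
        replace (F n - 1) with (F n - 1 / 1 * 1) by field; exact H.
      + apply is_series_geom_scal; split; [apply Cmod_ge_0 | exact Hx].
      + intros k; rewrite Cmod_mult, Rmult_assoc.
        apply Rmult_le_compat; auto using Cmod_ge_0.
        rewrite Cpow_S, Cmod_mult.
        apply Rmult_le_compat; auto using Cmod_ge_0.
        * rewrite Cmod_mult, Cmod_pow.
          generalize (Cpow_le_1 q n Hq) (Cmod_ge_0 x); intros; nra.
        * rewrite Cmod_pow; apply pow_incr; split; [apply Cmod_ge_0 | apply Hxq].
    - replace (Finite 0) with (Rbar_mult (B * / (1 - Cmod x))%R 0%R) by (simpl; f_equal; ring).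
      apply is_lim_seq_scal_l, is_lim_seq_geom; rewrite Rabs_pos_eq; lra. }
  assert (E : F 0%nat * qpoch_inf x q = qpoch_inf (a * x) q * 1).
  { apply (filterlim_C_unique (fun n => F 0%nat * qpoch x q n)).
    - apply filterlim_C_mult; [apply filterlim_const | apply filterlim_qpoch, Hq].
    - apply (filterlim_ext (fun n => qpoch (a * x) q n * F n));
        [intros n; symmetry; apply Hiter|].
      apply filterlim_C_mult; [apply filterlim_qpoch, Hq | exact Hlim]. }
  replace (qpoch_inf (a * x) q / qpoch_inf x q) with (F 0%nat).
  - refine (is_series_C_ext _ _ _ _ (HF 0%nat)); intros k; simpl; rewrite Cmult_1_r; reflexivity.
  - assert (Hne := qpoch_inf_neq_0 x q Hq Hx).
    rewrite Cmult_1_r in E; rewrite <- E; field; exact Hne.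
Qed.

(** * The q-Sylvester polynomials as a convolution *)

Lemma triangular_succ (k : nat) : (S k * (S k - 1) / 2 = k + k * (k - 1) / 2)%nat.
Proof.
  replace (S k * (S k - 1))%nat with (k * 2 + k * (k - 1))%nat by (destruct k; nia).
  apply Nat.div_add_l; discriminate.
Qed.

Lemma Cpowz_opp_nat (q : C) (n : nat) : Cpowz q (- Z.of_nat n) = / q ^ n.
Proof.
  destruct n as [|n]; [simpl; field|].
  cbn [Z.of_nat Z.opp Cpowz]; rewrite SuccNat2Pos.id_succ; reflexivity.
Qed.

(** Reversal of [(q^-n;q)_k]: each factor is
    [1 - q^(i-n) = - q^(i-n) (1 - q^(n-i))], and the factors [1 - q^(n-i)] for
    [i < k] are those that [(q;q)_n] has beyond [(q;q)_(n-k)]. *)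
Lemma qpoch_neg_power (q : C) (n k : nat) :
  q <> 0 -> (k <= n)%nat ->
  qpoch (/ q ^ n) q k * qpoch q q (n - k) * (q ^ n) ^ k
  = qpoch q q n * ((- (1)) ^ k * q ^ (k * (k - 1) / 2)).
Proof.
  intros Hq; induction k as [|k IH]; intros Hk.
  - rewrite Nat.sub_0_r; simpl; ring.
  - rewrite triangular_succ, Cpow_add_r.
    specialize (IH ltac:(lia)).
    replace (n - k)%nat with (S (n - S k)) in IH by lia.
    assert (E : q ^ n = q ^ k * (q * q ^ (n - S k)))
      by (rewrite <- Cpow_S, <- Cpow_add_r; f_equal; lia).
    assert (Hn : q ^ n <> 0) by (apply Cpow_nz, Hq).
    cbn [qpoch] in IH |- *; rewrite !Cpow_S.
    transitivity (- q ^ k * (qpoch q q n * ((- (1)) ^ k * q ^ (k * (k - 1) / 2)))); [|ring].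
    rewrite <- IH.
    transitivity (qpoch (/ q ^ n) q k * qpoch q q (n - S k) * (q ^ n) ^ k * (q ^ n - q ^ k));
      [field; exact Hn|].
    rewrite E at 3; ring.
Qed.

Lemma qpoch_neg_power_vanish (q : C) (n k : nat) :
  q <> 0 -> (n < k)%nat -> qpoch (/ q ^ n) q k = 0.
Proof.
  intros Hq Hk; replace k with (S n + (k - S n))%nat by lia.
  assert (Hn : q ^ n <> 0) by (apply Cpow_nz, Hq).
  rewrite qpoch_add; simpl; field; exact Hn.
Qed.

Definition sylvester_conv (w q z : C) (n : nat) : C :=
  sum_n (fun k => qbinom_coef w q k * (z ^ (n - k) / qpoch q q (n - k))) n.

Lemma qSylvester_eq_convolution (n : nat) (z q : C) :
  (Cmod q < 1)%R -> q <> 0 -> z <> 0 -> qSylvester n z q = sylvester_conv (Cpowc q z) q z n.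
Proof.
  intros Hq Hq0 Hz; unfold qSylvester, qhyp.
  rewrite Cpowz_opp_nat.
  erewrite CSeries_correct; [|apply (is_series_C_finite _ n)].
  - unfold sylvester_conv; etransitivity; [symmetry; apply sum_n_C_mult|].
    apply sum_n_C_ext; intros k Hk.
    assert (HE := qpoch_neg_power q n k Hq0 Hk).
    unfold qhyp_term, qpochs, qbinom_coef.
    replace (1 + Z.of_nat (length (@nil C)) - Z.of_nat (length [/ q ^ n; Cpowc q z]))%Z
      with (-1)%Z by reflexivity.
    cbn [fold_right Cpowz]; change (Pos.to_nat 1) with 1%nat; rewrite Cpow_1_r.
    rewrite Cpow_mult_l, (Cpow_inv z k Hz).
    assert (Hzn : z ^ n = z ^ k * z ^ (n - k)) by (rewrite <- Cpow_add_r; f_equal; lia).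
    rewrite Hzn.
    assert (N1 := qpoch_neq_0 q q n Hq Hq).
    assert (N2 := qpoch_neq_0 q q k Hq Hq).
    assert (N3 := qpoch_neq_0 q q (n - k) Hq Hq).
    assert (N4 := Cpow_nz z k Hz).
    assert (N5 := Cpow_nz q (k * (k - 1) / 2) Hq0).
    assert (N6 : (- (1)) ^ k <> 0).
    { apply Cpow_nz; intros H; apply (f_equal Cmod) in H.
      rewrite Cmod_m1, Cmod_0 in H; lra. }
    set (s := (- (1)) ^ k) in *; set (p := q ^ (k * (k - 1) / 2)) in *.
    transitivity (qpoch (/ q ^ n) q k * qpoch q q (n - k) * (q ^ n) ^ k
                  / (qpoch q q n * (s * p))
                  * (qpoch (Cpowc q z) q k / qpoch q q k * (z ^ (n - k) / qpoch q q (n - k)))).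
    + field; repeat split; assumption.
    + rewrite HE; field; repeat split; assumption.
  - intros k Hk; unfold qhyp_term, qpochs; cbn [fold_right].
    rewrite (qpoch_neg_power_vanish q n k Hq0 Hk).
    unfold Cdiv; ring.
Qed.

(** * The generating function *)

(** The general term of the 2-phi-1 series with numerator parameters [A], [w]
    and denominator parameter [c]. *)
Definition heine_term (A w c q t : C) (k : nat) : C :=
  qpoch A q k * qpoch w q k / (qpoch c q k * qpoch q q k) * t ^ k.

Lemma ex_series_heine (A w c q t : C) :
  (Cmod q < 1)%R -> (Cmod c < 1)%R -> (Cmod t < 1)%R -> ex_series (heine_term A w c q t).
Proof.
  intros Hq Hc Ht; destruct (inv_qpoch_bound q q Hq Hq) as [B HB].
  set (bA := exp (Cmod A / (1 - Cmod q))); set (bw := exp (Cmod w / (1 - Cmod q))).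
  destruct (inv_qpoch_bound c q Hq Hc) as [B' HB'].
  apply (ex_series_C_geom _ (bA * bw * (B' * B)) (Cmod t));
    [split; [apply Cmod_ge_0 | exact Ht]|].
  intros k; assert (Hk := qpoch_neq_0 c q k Hq Hc); assert (Hk' := qpoch_neq_0 q q k Hq Hq).
  replace (heine_term A w c q t k)
    with (qpoch A q k * qpoch w q k * (/ qpoch c q k * / qpoch q q k) * t ^ k)
    by (unfold heine_term; field; split; assumption).
  rewrite !Cmod_mult, Cmod_pow.
  apply Rmult_le_compat_r; [apply pow_le, Cmod_ge_0|].
  repeat apply Rmult_le_compat; repeat apply Rmult_le_pos; try apply Cmod_ge_0;
    auto; apply qpoch_upper_bound, Hq.
Qed.

(** Only [(A;q)_(k+j)] couples the two indices of the double series, and it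
    splits as [(A;q)_k (A q^k;q)_j]; hence each row is a q-binomial series in
    [z t]. *)
Theorem generating_function (A w q z t s : C) :
  (Cmod q < 1)%R -> (Cmod t < 1)%R -> (Cmod (z * t) < 1)%R -> (Cmod (z * t * A) < 1)%R ->
  is_series (heine_term A w (z * t * A) q t) s ->
  is_series (fun n => qpoch A q n * sylvester_conv w q z n * t ^ n)
    (qpoch_inf (z * t * A) q / qpoch_inf (z * t) q * s).
Proof.
  intros Hq Ht Hzt HztA HS.
  set (f := fun k j => qpoch A q (k + j) * qbinom_coef w q k * (/ qpoch q q j)
                       * t ^ k * (z * t) ^ j).
  set (r := Rmax (Cmod t) (Cmod (z * t))).
  assert (Hr : (0 <= r < 1)%R).
  { split; [eapply Rle_trans; [apply Cmod_ge_0 | apply Rmax_l] | apply Rmax_lub_lt; assumption]. }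
  destruct (inv_qpoch_bound q q Hq Hq) as [B HB].
  destruct (qbinom_coef_bound w q Hq) as [B' HB'].
  apply (is_series_C_ext (fun n => sum_n (fun k => f k (n - k)%nat) n)).
  { intros n; unfold sylvester_conv.
    transitivity (qpoch A q n * t ^ n *
      sum_n (fun k => qbinom_coef w q k * (z ^ (n - k) / qpoch q q (n - k))) n); [|ring].
    etransitivity; [|apply sum_n_C_mult].
    apply sum_n_C_ext; intros k Hk; unfold f.
    replace (k + (n - k))%nat with n by lia.
    rewrite Cpow_mult_l.
    replace (t ^ n) with (t ^ k * t ^ (n - k)) by (rewrite <- Cpow_add_r; f_equal; lia).
    unfold Cdiv; ring. }
  apply (is_series_diagonal f
           (fun k => qpoch_inf (z * t * A) q / qpoch_inf (z * t) q
                     * heine_term A w (z * t * A) q t k)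
           _ (exp (Cmod A / (1 - Cmod q)) * B' * B) r Hr).
  - intros k j; unfold f.
    rewrite !Cmod_mult, !Cmod_pow, pow_add, <- Rmult_assoc.
    repeat apply Rmult_le_compat; repeat apply Rmult_le_pos;
      try apply Cmod_ge_0; try (apply pow_le, Cmod_ge_0); auto using qpoch_upper_bound.
    + apply pow_incr; split; [apply Cmod_ge_0 | apply Rmax_l].
    + apply pow_incr; split; [apply Cmod_ge_0 | apply Rmax_r].
  - intros k.
    assert (H := q_binomial (A * q ^ k) q (z * t) Hq Hzt).
    apply (is_series_C_scal (qpoch A q k * qbinom_coef w q k * t ^ k)) in H.
    replace (A * q ^ k * (z * t)) with (z * t * A * q ^ k) in H by ring.
    assert (N1 := qpoch_neq_0 _ q k Hq HztA).
    assert (N2 := qpoch_inf_neq_0 _ q Hq Hzt).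
    assert (N3 := qpoch_neq_0 _ q k Hq Hq).
    replace (qpoch_inf (z * t * A) q / qpoch_inf (z * t) q * heine_term A w (z * t * A) q t k)
      with (qpoch A q k * qbinom_coef w q k * t ^ k *
            (qpoch_inf (z * t * A * q ^ k) q / qpoch_inf (z * t) q)).
    + refine (is_series_C_ext _ _ _ _ H); intros j; unfold f.
      rewrite qpoch_add; unfold qbinom_coef at 2; unfold Cdiv; ring.
    + rewrite (qpoch_inf_shift (z * t * A) q k Hq); unfold heine_term, qbinom_coef.
      field; repeat split; assumption.
  - apply is_series_C_scal, HS.
Qed.

Theorem theorem3p5 (q z lambda : C) (hq0 : (0 < Cmod q)%R) (hq1 : (Cmod q < 1)%R)
  (hz : z <> 0) :
  exists delta : R, (0 < delta)%R /\
    forall t : C, (Cmod t < delta)%R ->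
      (* the denominators on the right-hand sides do not vanish *)
      (qpoch_inf t q <> 0 /\ qpoch_inf (z * t) q <> 0 /\
       qpoch_inf (z * t * Cpowc q lambda) q <> 0 /\
       (forall k : nat, qpoch (z * t * Cpowc q lambda) q k <> 0)) /\
      is_series (fun n : nat => qSylvester n z q * t ^ n)
        (qpoch_inf (Cpowc q z * t) q / (qpoch_inf t q * qpoch_inf (z * t) q)) /\
      (ex_series
         (qhyp_term [Cpowc q lambda; Cpowc q z] [z * t * Cpowc q lambda] q t) /\
       is_series
         (fun n : nat => qpoch (Cpowc q lambda) q n * qSylvester n z q * t ^ n)
         (1 / qpoch_cplx (z * t) q lambda *
          qhyp [Cpowc q lambda; Cpowc q z] [z * t * Cpowc q lambda] q t)).
Proof.
  assert (Hq : q <> 0) by (apply Cmod_gt_0; exact hq0).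
  set (A := Cpowc q lambda); set (w := Cpowc q z).
  assert (HA := Cmod_ge_0 A); assert (Hz := Cmod_ge_0 z).
  (* [|t| < 1 / K] puts [t], [z t] and [z t q^lambda] all in the open unit disc. *)
  set (K := ((1 + Cmod z) * (1 + Cmod A))%R).
  assert (HK : (0 < K)%R) by (unfold K; nra).
  exists (/ K)%R; split; [apply Rinv_0_lt_compat, HK|].
  intros t Ht; assert (Ht0 := Cmod_ge_0 t).
  assert (HtK : (Cmod t * (1 + Cmod z) * (1 + Cmod A) < 1)%R).
  { apply (Rmult_lt_compat_r K) in Ht; [|exact HK].
    rewrite Rinv_l in Ht by lra; rewrite Rmult_assoc; exact Ht. }
  assert (H0 : (0 <= Cmod t * Cmod z)%R) by nra.
  assert (H0' : (0 <= Cmod t * Cmod A)%R) by nra.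
  assert (H0'' : (0 <= Cmod t * Cmod z * Cmod A)%R) by nra.
  assert (Ht1 : (Cmod t < 1)%R) by nra.
  assert (Hzt : (Cmod (z * t) < 1)%R) by (rewrite Cmod_mult; nra).
  assert (HztA : (Cmod (z * t * A) < 1)%R) by (rewrite !Cmod_mult; nra).
  assert (N1 := qpoch_inf_neq_0 _ q hq1 Ht1).
  assert (N2 := qpoch_inf_neq_0 _ q hq1 Hzt).
  assert (N3 := qpoch_inf_neq_0 _ q hq1 HztA).
  split; [|split].
  - repeat split; try assumption; intros k; apply qpoch_neq_0; assumption.
  - (* The case [A = 0]: all symbols [(0;q)_n] are 1. *)
    assert (E : (Cmod (z * t * 0) < 1)%R) by (rewrite Cmult_0_r, Cmod_0; lra).
    assert (H : is_series (heine_term 0 w (z * t * 0) q t) (qpoch_inf (w * t) q / qpoch_inf t q)).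
    { refine (is_series_C_ext _ _ _ _ (q_binomial w q t hq1 Ht1)); intros k.
      unfold heine_term, qbinom_coef; rewrite Cmult_0_r, !qpoch_0_l; field.
      apply qpoch_neq_0; exact hq1. }
    apply (generating_function 0 w q z t) in H; try assumption.
    rewrite Cmult_0_r, qpoch_inf_0_l in H.
    replace (qpoch_inf (w * t) q / (qpoch_inf t q * qpoch_inf (z * t) q))
      with (1 / qpoch_inf (z * t) q * (qpoch_inf (w * t) q / qpoch_inf t q))
      by (field; split; assumption).
    refine (is_series_C_ext _ _ _ _ H); intros n.
    rewrite qpoch_0_l, qSylvester_eq_convolution by assumption; fold w; ring.
  - assert (E : forall k, heine_term A w (z * t * A) q t k
                          = qhyp_term [A; w] [z * t * A] q t k).
    { intros k; unfold heine_term, qhyp_term, qpochs.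
      replace (1 + Z.of_nat (length [(z * t * A)%C]) - Z.of_nat (length [A; w]))%Z
        with 0%Z by reflexivity.
      cbn [fold_right Cpowz]; field; split; apply qpoch_neq_0; assumption. }
    destruct (ex_series_heine A w (z * t * A) q t hq1 HztA Ht1) as [s HS].
    assert (HS' := is_series_C_ext _ _ _ E HS).
    split; [exists s; exact HS'|].
    unfold qhyp; rewrite (CSeries_correct _ _ HS').
    unfold qpoch_cplx; fold A.
    replace (1 / (qpoch_inf (z * t) q / qpoch_inf (z * t * A) q))
      with (qpoch_inf (z * t * A) q / qpoch_inf (z * t) q)
      by (field; split; assumption).
    refine (is_series_C_ext _ _ _ _ (generating_function A w q z t s hq1 Ht1 Hzt HztA HS)).
    intros n; rewrite qSylvester_eq_convolution by assumption; reflexivity.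
Qed.
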